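(* For every odd positive integer $x$ there exist integers $i\ge1$ and $m\ge1$ with the following property. Let $w$ be the binary string obtained from $s_i^m$ by deleting its leading zeros. Then the binary representation of $x$ (without leading zeros) is a prefix of $w$.
   Context: For $i\ge1$, the binary expansion of $1/3^i$ is purely periodic with period $2\cdot 3^{i-1}$. The seed $s_i$ of order $i$ is its repetend: the binary string of length $2\cdot3^{i-1}$ such that $1/3^i=0.s_is_is_i\dots$ in binary. For $m\ge1$, $s_i^m$ denotes the concatenation of $m$ copies of $s_i$ (a power of the seed). *)

(* Defs.v *)
From mathcomp Require Import all_boot all_order all_algebra.
From mathcomp Require Import all_classical all_reals all_analysis.
Import Order.TTheory GRing.Theory Num.Theory.
Import numFieldNormedType.Exports.

Set Implicit Arguments.
Unset Strict Implicit.
Unset Printing Implicit Defensive.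

Local Open Scope classical_set_scope.
Local Open Scope ring_scope.

(* Binary strings are [bitseq]s with the most significant digit first;
   [true] is the digit 1. *)

(* y = 0.a_0 a_1 a_2 ... in base 2, so that a_k has weight 2^-(k+1). *)
Definition binary_expansion (R : realType) (a : nat -> bool) (y : R) : Prop :=
  series (fun k : nat => (a k)%:R / 2 ^+ k.+1 : R) @ \oo --> y.

(* For i >= 1 this determines s: the number 1/3^i is not dyadic, hence has
   only one binary expansion, and the length of s is prescribed. *)
Definition is_seed (R : realType) (i : nat) (s : bitseq) : Prop :=
  size s = (2 * 3 ^ i.-1)%N /\
  binary_expansion (fun k => nth false s (k %% size s)) (3 ^- i : R).

Definition string_power (s : bitseq) (m : nat) : bitseq := flatten (nseq m s).

(* [find id w] is the position of the first 1 of w (or [size w]). *)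
Definition strip_zeros (w : bitseq) : bitseq := drop (find id w) w.

(* For x > 0, the digits of x of weights 2^d, ..., 2^0, where
   2^d <= x < 2^(d+1). *)
Definition binary_rep (x : nat) : bitseq :=
  rev [seq odd (x %/ 2 ^ k) | k <- iota 0 (trunc_log 2 x).+1].

(* Main.v *)
(** It suffices to find i, k >= 1 with
    x * 3^i <= 2^k < (x + 1) * 3^i: then x = floor (2^k / 3^i) is spelled by
    the first k binary digits of 1/3^i.  Scaling each 3^-i by a power of 2 into
    [1, 2), the pigeonhole principle gives a ratio 2^a / 3^b <> 1 within a factor
    1 + 1/x of 1, and a geometric progression with that ratio cannot jump over
    the interval [x, x + 1). *)
Require Import Defs.
From mathcomp Require Import all_boot all_order all_algebra.
From mathcomp Require Import all_classical all_reals all_analysis.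
From mathcomp Require Import cyclic zify.
Import Order.TTheory GRing.Theory Num.Theory.
Import numFieldNormedType.Exports.

(** * Powers of 2 near multiples of powers of 3 *)

(** Bernoulli's inequality [(A/B)^n >= (1 + 1/B)^n >= 1 + n/B], cleared of denominators. *)
Lemma expn_bernoulli (A B n : nat) : B < A -> B ^ n * (n + B) <= A ^ n * B.
Proof.
move=> ltBA; elim: n => [|n IHn]; first by rewrite !expn0 !mul1n.
rewrite !expnS -(mulnA A).
apply: leq_trans (leq_mul ltBA IHn).
rewrite mulnAC [B.+1 * _]mulnCA mulnC leq_mul2l; apply/orP; right; nia.
Qed.

Lemma expn_ratio_unbounded (A B C : nat) :
  0 < B -> B < A -> exists n, C * B ^ n <= A ^ n.
Proof.
move=> B_gt0 ltBA; exists (C * B).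
have := @expn_bernoulli A B (C * B) ltBA.
set P := B ^ _; set Q := A ^ _ => H.
have : P * (C * B) <= Q * B by apply: leq_trans H; rewrite leq_mul2l leq_addr orbT.
by rewrite mulnA leq_pmul2r // mulnC.
Qed.

Lemma pow2_neq_pow3 (a b : nat) : 0 < b -> 2 ^ a != 3 ^ b.
Proof.
move=> b_gt0; apply/eqP => /[dup] /(congr1 odd).
rewrite !oddX /= orbT orbF => /eqP ->.
by case: b b_gt0 => // b _; rewrite expn0 expnS; lia.
Qed.

(** [A/B < 1 + 1/q <= 1 + 1/x], without fractions. *)
Lemma ltn_ratio_succ (x q A B : nat) :
  0 < x <= q -> q * A < q.+1 * B -> x * A < x.+1 * B.
Proof.
case/andP=> x_gt0 le_xq ltAB; have q_gt0 := leq_trans x_gt0 le_xq.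
have : x * (q * A) < x * (q.+1 * B) by rewrite ltn_pmul2l.
move=> lt_x; rewrite -(@ltn_pmul2l q) // mulnCA; apply: (leq_trans lt_x).
rewrite !mulnA leq_mul2r; apply/orP; right; lia.
Qed.

Lemma close_pow2_pow3 (x : nat) : 0 < x ->
  exists a b, [/\ 0 < b, x * 2 ^ a < x.+1 * 3 ^ b & x * 3 ^ b < x.+1 * 2 ^ a].
Proof.
move=> x_gt0; pose k i := up_log 2 (3 ^ i).
have lek i : 3 ^ i <= 2 ^ k i by exact: up_logP.
have ltk i : 2 ^ k i < 2 * 3 ^ i.
  rewrite /k; case: i => [|i]; first by rewrite expn0 up_log1.
  have i3 : 1 < 3 ^ i.+1 by rewrite -{1}(expn0 3) ltn_exp2l.
  have /andP[lt3 _] := up_log_bounds (isT : 1 < 2) i3.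
  have : 0 < up_log 2 (3 ^ i.+1) by rewrite up_log_gt0 i3.
  by case: (up_log _ _) lt3 => // u lt3 _; rewrite expnS ltn_pmul2l.
have kS i j : i <= j -> k i <= k j.
  by move=> ij; apply: leq_up_log; rewrite leq_exp2l.
(* The scaled value [2 ^ k i / 3 ^ i] lies in [1, 2), so [f] takes values in [x, 2x), and two of 2x
   + 1 indices must collide. *)
pose f i := x * 2 ^ k i %/ 3 ^ i.
have f_lt i : f i < 2 * x.
  by rewrite ltn_divLR ?expn_gt0 // [2 * x]mulnC -mulnA ltn_pmul2l.
have /injectivePn[i0 [j0 neq ff]] :
    ~~ injectiveb (fun i : 'I_(2 * x).+1 => Ordinal (f_lt i)).
  by apply/negP => /injectiveP /leq_card; rewrite !card_ord ltnn.
move/(congr1 val): ff => /= ff.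
have [i [j [ij fij]]] : exists i j, i < j /\ f i = f j.
  have [lt|lt|eq] := ltngtP i0 j0; last by rewrite (val_inj eq) eqxx in neq.
    by exists i0, j0.
  by exists j0, i0.
have bounds n : f n * 3 ^ n <= x * 2 ^ k n < (f n).+1 * 3 ^ n.
  by rewrite leq_trunc_div -ltn_divLR ?expn_gt0 ?ltnSn.
have xf n : x <= f n by rewrite leq_divRL ?expn_gt0 // leq_mul2l lek orbT.
have [b [b_gt0 jE]] : exists b, 0 < b /\ j = i + b.
  by exists (j - i); rewrite subn_gt0 subnKC // ltnW.
have [a kE] : exists a, k j = k i + a.
  by exists (k j - k i); rewrite subnKC // kS // ltnW.
have /andP[loi hii] := bounds i; have /andP[loj hij] := bounds j.
move: (xf i) loi hii loj hij; rewrite -fij kE jE !expnD.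
have : 0 < 3 ^ i by rewrite expn_gt0.
have : 0 < 2 ^ a by rewrite expn_gt0.
move=> A_gt0 T_gt0 le_xq loi hii loj hij; exists a, b.
move: (f i) (2 ^ k i) (3 ^ i) (2 ^ a) (3 ^ b) A_gt0 T_gt0 le_xq loi hii loj hij.
move=> q P T A B A_gt0 T_gt0 le_xq loi hii loj hij.
(* With [q] the common value of [f], [x * P] lies in [qT, (q+1)T) and [x * P * A] in [qTB, (q+1)TB).
   Comparing both through [x * P * A] bounds A/B and B/A by (q+1)/q. *)
split=> //; apply: (@ltn_ratio_succ x q); rewrite ?x_gt0 // -(@ltn_pmul2l T) //.
  apply: (@leq_ltn_trans (x * (P * A))); last by rewrite (mulnCA T).
  by rewrite !mulnA leq_mul2r [T * q]mulnC; rewrite loi orbT.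
apply: (@leq_ltn_trans (x * (P * A))); first by rewrite (mulnCA T).
by rewrite !mulnA ltn_pmul2r // [T * _]mulnC.
Qed.

Lemma pow2_leading_digits (x : nat) : 0 < x ->
  exists i k, [/\ 0 < i, 0 < k & 2 ^ k %/ 3 ^ i = x].
Proof.
move=> x_gt0.
suff [i [k [i_gt0 lo hi]]] :
    exists i k, [/\ 0 < i, x * 3 ^ i <= 2 ^ k & 2 ^ k < x.+1 * 3 ^ i].
  exists i, k; split=> //.
    case: k lo {hi} => // ; rewrite expn0 => lo.
    have : 1 * 3 ^ 1 <= x * 3 ^ i by rewrite leq_mul ?leq_exp2l.
    by rewrite expn1; lia.
  apply/eqP; rewrite eqn_leq leq_divRL ?expn_gt0 // lo andbT.
  by rewrite -ltnS ltn_divLR ?expn_gt0.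
have [a [b [b_gt0 xAB xBA]]] := @close_pow2_pow3 x x_gt0.
have B_gt0 : 0 < 3 ^ b by rewrite expn_gt0.
have A_gt0 : 0 < 2 ^ a by rewrite expn_gt0.
have [ltAB|ltBA|/eqP] := ltngtP (2 ^ a) (3 ^ b); last first.
- by rewrite (negPf (@pow2_neq_pow3 a b b_gt0)).
(* Increasing progression [(2/3) (A/B)^n]: it starts below x even when x = 1, and its first term
   reaching x is below x + 1. The initial factor 1/3 makes the exponent of 3 positive. *)
- have ex : exists n, x * 3 * (3 ^ b) ^ n <= 2 * (2 ^ a) ^ n.
    have [n n_ub] := @expn_ratio_unbounded (2 ^ a) (3 ^ b) (x * 3) B_gt0 ltBA.
    by exists n; apply: leq_trans n_ub _; rewrite leq_pmull.
  case: (ex_minnP ex) => [[|n] lo min_n]; first by move: lo; rewrite !expn0; lia.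
  have /= := contraNN (min_n n); rewrite ltnn -ltnNge => /(_ isT) hi.
  exists (b * n.+1).+1, (a * n.+1).+1.
  rewrite !(expnS _ (_ * _)) !expnM !mulnA; split=> //.
  move: hi; rewrite !expnS; move: (_ ^ n) (_ ^ n) => Q P hi.
  rewrite -(@ltn_pmul2l x) //; nia.
(* Decreasing progression [(2^c/3) (A/B)^n]: it starts at or above x + 1, and its first term below x
   + 1 is still at least x. *)
have [c c_ub] : exists c, x.+1 * 3 <= 2 ^ c.
  by exists (x.+1 * 3); exact: ltnW (ltn_expl _ _).
have ex : exists n, 2 ^ c * (2 ^ a) ^ n < x.+1 * 3 * (3 ^ b) ^ n.
  have [n n_ub] := @expn_ratio_unbounded (3 ^ b) (2 ^ a) (2 ^ c) A_gt0 ltAB.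
  exists n; apply: leq_ltn_trans n_ub _; apply: ltn_Pmull; first by lia.
  by rewrite expn_gt0 B_gt0.
case: (ex_minnP ex) => [[|n] hi min_n].
  by move: hi; rewrite !expn0 !muln1 ltnNge c_ub.
have /= := contraNN (min_n n); rewrite ltnn -leqNgt => /(_ isT) lo.
exists (b * n.+1).+1, (c + a * n.+1).
rewrite expnD (expnS _ (_ * _)) !expnM !mulnA; split=> //.
move: lo; rewrite !expnS; move: (_ ^ n) (_ ^ n) => Q P lo.
nia.
Qed.

(** * Binary digits of 1/d *)

(** For d > 1, the digit of 1/d of weight 2^-(j+1). *)
Definition recip_digit (d j : nat) : bool := odd (2 ^ j.+1 %/ d).

(** Halving [2 ^ n.+1 %/ d] yields [2 ^ n %/ d], and the bit dropped is digit n. *)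
Lemma recip_digit_sum (R : realType) (d n : nat) : 1 < d ->
  (\sum_(0 <= j < n) (recip_digit d j)%:R / 2 ^+ j.+1 =
     (2 ^ n %/ d)%:R / 2 ^+ n :> R)%R.
Proof.
move=> d_gt1; elim: n => [|n IHn].
  by rewrite big_nil expn0 divn_small // mul0r.
have half : (2 ^ n.+1 %/ d)./2 = 2 ^ n %/ d.
  by rewrite -divn2 divnAC expnS mulKn.
rewrite big_nat_recr //= IHn -[in RHS](odd_double_half (2 ^ n.+1 %/ d)) half.
rewrite -/(recip_digit d n) natrD mulrDl addrC -muln2 natrM exprS.
by rewrite [(2 * _ ^+ _)%R]mulrC -mulf_div divff ?mulr1 // pnatr_eq0.
Qed.

Lemma recip_binary_expansion (R : realType) (d : nat) : 1 < d ->
  binary_expansion (recip_digit d) (d%:R^-1 : R)%R.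
Proof.
move=> d_gt1; have d_gt0 : (0 < d%:R :> R)%R by rewrite ltr0n ltnW.
have two_gt0 n : (0 < 2 ^+ n :> R)%R by rewrite exprn_gt0.
rewrite /binary_expansion.
have -> : series (fun k : nat => (recip_digit d k)%:R / 2 ^+ k.+1 : R)%R =
          (fun n => (2 ^ n %/ d)%:R / 2 ^+ n)%R.
  by apply/funext => n; rewrite -recip_digit_sum.
(* Truncation after n digits loses less than 2^-n. *)
apply: (@squeeze_cvgr _ _ _ _ (fun n => d%:R^-1 - 2^-1 ^+ n)%R
                              (fun=> d%:R^-1)%R); last exact: cvg_cst.
  apply: nearW => n; rewrite exprVn; apply/andP; split.
    rewrite lerBlDr -[X in (_ <= _ + X)%R]mul1r -mulrDl natr1.
    rewrite -ler_pdivrMr ?invr_gt0 // invrK mulrC ler_pdivrMr // -natrX -natrM.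
    by rewrite ler_nat ltnW // -ltn_divLR ?ltnSn // ltnW.
  rewrite ler_pdivrMr // mulrC ler_pdivlMr // -natrX -natrM ler_nat.
  exact: leq_trunc_div.
rewrite -[X in (_ --> X)%classic]subr0; apply: cvgB; first exact: cvg_cst.
by apply: cvg_expr; rewrite ger0_norm ?invr_ge0 // invf_lt1 // ltr1n.
Qed.

Lemma recip_digit_periodic (d p j : nat) :
  2 ^ p = 1 %[mod d] -> recip_digit d (p + j) = recip_digit d j.
Proof.
move=> modp; have /dvdnP[q qE] : d %| 2 ^ p - 1.
  by rewrite -eqn_mod_dvd ?expn_gt0 //; exact/eqP.
have pE : 2 ^ p = q * d + 1 by rewrite -qE subnK // expn_gt0.
rewrite /recip_digit -addnS expnD pE mulnDl mul1n.
have [->|d_gt0] := posnP d; first by rewrite !divn0.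
(* Shifting by p adds [q * 2 ^ j.+1] to the quotient, which is even. *)
by rewrite mulnAC divnMDl // oddD oddM oddX /= andbF.
Qed.

Lemma recip_digit_modn (d p j : nat) :
  2 ^ p = 1 %[mod d] -> recip_digit d (j %% p) = recip_digit d j.
Proof.
move=> modp; rewrite [in RHS](divn_eq j p).
elim: (j %/ p) => [|q IHq] //.
by rewrite mulSn -addnA recip_digit_periodic.
Qed.

(** * Seeds, their powers and binary representations *)

Lemma string_power_mkseq (a : nat -> bool) (p m : nat) :
  (forall j, a (p + j) = a j) ->
  string_power (mkseq a p) m = mkseq a (m * p).
Proof.
move=> a_per; elim: m => [|m IHm] //.
rewrite /string_power /= -/(string_power _ m) IHm mulSn.
rewrite /mkseq iotaD map_cat add0n.
have -> : iota p (m * p) = [seq p + j | j <- iota 0 (m * p)].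
  by rewrite -iotaDl addn0.
rewrite -map_comp.
by congr (_ ++ _); apply: eq_map => j /=; rewrite a_per.
Qed.

(** Euler's theorem: the exponent is the totient of 3^i. *)
Lemma pow2_mod_pow3 (i : nat) : 0 < i -> 2 ^ (2 * 3 ^ i.-1) = 1 %[mod 3 ^ i].
Proof.
move=> i_gt0; have := @Euler_exp_totient 2 (3 ^ i) _.
by rewrite totient_pfactor //=; apply; rewrite coprimeXr.
Qed.

Lemma pow3_is_seed (R : realType) (i : nat) : 0 < i ->
  is_seed R i (mkseq (recip_digit (3 ^ i)) (2 * 3 ^ i.-1)).
Proof.
move=> i_gt0; split; first by rewrite size_mkseq.
rewrite -natrX size_mkseq.
have -> : (fun k => nth false (mkseq (recip_digit (3 ^ i)) (2 * 3 ^ i.-1))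
                        (k %% (2 * 3 ^ i.-1))) = recip_digit (3 ^ i).
  apply/funext => k; rewrite nth_mkseq ?recip_digit_modn ?pow2_mod_pow3 //.
  by rewrite ltn_pmod // muln_gt0 expn_gt0.
by apply: recip_binary_expansion; rewrite -{1}(expn0 3) ltn_exp2l.
Qed.

Lemma binary_rep_mkseq (x : nat) :
  binary_rep x = mkseq (fun j => odd (x %/ 2 ^ (trunc_log 2 x - j)))
                       (trunc_log 2 x).+1.
Proof.
apply: (@eq_from_nth _ false).
  by rewrite size_rev size_mkseq size_map size_iota.
move=> j; rewrite size_rev size_map size_iota => lt_j.
rewrite nth_rev ?size_map ?size_iota // nth_mkseq //.
by rewrite (nth_map 0) ?size_iota ?nth_iota ?subSS ?add0n // ltnS leq_subr.
Qed.

Lemma head_binary_rep (x : nat) : 0 < x ->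
  exists r, binary_rep x = true :: r.
Proof.
move=> x_gt0; rewrite binary_rep_mkseq /mkseq /=; eexists; congr (_ :: _).
have /andP[lo hi] := trunc_log_bounds (isT : 1 < 2) x_gt0.
suff -> : x %/ 2 ^ (trunc_log 2 x - 0) = 1 by [].
rewrite subn0; apply/eqP; rewrite eqn_leq divn_gt0 ?expn_gt0 // lo andbT.
by rewrite -ltnS ltn_divLR ?expn_gt0 // -expnS.
Qed.

(** For j < k, digit j of 1/d is bit k - j - 1 of [2 ^ k %/ d]; the bits above the leading one of x
    form the zero padding. *)
Lemma recip_digits_binary_rep (d k x : nat) : 1 < d ->
  0 < x -> 2 ^ k %/ d = x ->
  exists n, mkseq (recip_digit d) k = nseq n false ++ binary_rep x.
Proof.
move=> d_gt1 x_gt0 xE; set t := trunc_log 2 x.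
have /andP[lo hi] := trunc_log_bounds (isT : 1 < 2) x_gt0.
have lt_tk : t < k.
  by rewrite -(@ltn_exp2l 2) // (leq_ltn_trans lo) // -xE ltn_Pdiv // expn_gt0.
have digitE j : j < k -> recip_digit d j = odd (x %/ 2 ^ (k - j.+1)).
  by move=> lt_jk; rewrite -xE divnAC -expnB ?leq_subr // subKn.
exists (k - t.+1); rewrite binary_rep_mkseq -/t.
apply: (@eq_from_nth _ false) => [|j].
  by rewrite size_cat size_nseq !size_mkseq subnK.
rewrite size_mkseq => lt_jk; rewrite nth_mkseq // digitE // nth_cat size_nseq.
case: ltnP => cmp.
  rewrite nth_nseq cmp divn_small // (leq_trans hi) // leq_exp2l //.
  by rewrite -/t; lia.
rewrite nth_mkseq; last by lia.
by congr (odd (_ %/ 2 ^ _)); lia.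
Qed.

Theorem theorem1 (R : realType) (x : nat) :
  odd x ->
  exists (i m : nat) (s : bitseq),
    [/\ (1 <= i)%N, (1 <= m)%N, is_seed R i s
      & prefix (binary_rep x) (strip_zeros (string_power s m))].
Proof.
move=> /odd_gt0 x_gt0.
have [i [k [i_gt0 k_gt0 xE]]] := @pow2_leading_digits x x_gt0.
pose p := 2 * 3 ^ i.-1.
have p_gt0 : 0 < p by rewrite muln_gt0 expn_gt0.
(* As p >= 1, k copies of the seed contain the first k digits of 1/3^i. *)
exists i, k, (mkseq (recip_digit (3 ^ i)) p); split=> //.
  exact: pow3_is_seed.
rewrite string_power_mkseq; last first.
  by move=> j; rewrite recip_digit_periodic // pow2_mod_pow3.
have d_gt1 : 1 < 3 ^ i by rewrite -{1}(expn0 3) ltn_exp2l.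
have [n nE] := @recip_digits_binary_rep (3 ^ i) k x d_gt1 x_gt0 xE.
have [r rE] := @head_binary_rep x x_gt0.
have le_k : k <= k * p by rewrite leq_pmulr.
(* Split after k digits: the first block is n zeros followed by [binary_rep x]. That string starts
   with 1, so stripping removes exactly the n zeros. *)
rewrite -(subnKC le_k) /mkseq iotaD map_cat.
rewrite -/(mkseq _ k) nE rE -catA /strip_zeros find_cat has_nseq andbF /=.
rewrite size_nseq addn0 drop_size_cat ?size_nseq // -cat_cons.
exact: prefix_prefix.
Qed.
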